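(* $\mathrm{S}^{\neq}$ and $\mathrm{S}^{=}$ are not closed under difference.
   Context: Let $\Gamma=\Sigma\cup\{¢,\$\}$, where ¢ and \$ are left and right end-markers. A PFA $\mathcal{P}=(S,\Sigma,\{\mathsf{A}_\sigma:\sigma\in\Gamma\},F)$ has states $S=\{s_1,\dots,s_n\}$ (start state $s_1$), real stochastic $n\times n$ transition matrices $\mathsf{A}_\sigma$, and accepting states $F$; its acceptance probability on $w\in\Sigma^*$ is $f_{\mathcal{P}}(w)=\sum_{s_i\in F}\mathsf{v}(i)$, where $\mathsf{v}=(1,0,\dots,0)\mathsf{A}_{¢}\mathsf{A}_{w_1}\cdots\mathsf{A}_{w_{|w|}}\mathsf{A}_{\$}$. $\mathrm{S}^{=}$ is the class of languages $\{w: f_{\mathcal{P}}(w)=\lambda\}$ and $\mathrm{S}^{\neq}$ the class of languages $\{w: f_{\mathcal{P}}(w)\neq\lambda\}$, for some PFA $\mathcal{P}$ and $\lambda\in[0,1]$. *)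

(* Defs.v *)
From HB Require Import structures.
From mathcomp Require Import all_boot all_order all_algebra.
From mathcomp Require Import boolp classical_sets reals.

Set Implicit Arguments.
Unset Strict Implicit.
Unset Printing Implicit Defensive.

Import Order.TTheory GRing.Theory Num.Theory.
Local Open Scope ring_scope.
Local Open Scope classical_set_scope.

Inductive tape_symbol (Sigma : Type) : Type :=
  | LeftEnd
  | Letter of Sigma
  | RightEnd.

Arguments LeftEnd {Sigma}.
Arguments RightEnd {Sigma}.

Definition tape (Sigma : Type) (w : seq Sigma) : seq (tape_symbol Sigma) :=
  LeftEnd :: rcons (map (@Letter Sigma) w) RightEnd.

(* Row-stochastic, since state distributions are row vectors. *)
Definition stochastic (R : realType) (n : nat) (A : 'M[R]_n) : Prop :=
  (forall i j, 0 <= A i j) /\ (forall i, \sum_j A i j = 1).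

(* The state set is 'I_pfa_dim.+1 (nonempty), with start state ord0. *)
Record pfa (R : realType) (Sigma : finType) := PFA {
  pfa_dim : nat;
  pfa_trans : tape_symbol Sigma -> 'M[R]_pfa_dim.+1;
  pfa_transP : forall s, stochastic (pfa_trans s);
  pfa_accept : {set 'I_pfa_dim.+1}
}.

Definition final_distribution (R : realType) (Sigma : finType)
    (P : pfa R Sigma) (w : seq Sigma) : 'rV[R]_(pfa_dim P).+1 :=
  foldl (fun v s => v *m pfa_trans P s) (delta_mx 0 ord0) (tape w).

Definition accept_prob (R : realType) (Sigma : finType)
    (P : pfa R Sigma) (w : seq Sigma) : R :=
  \sum_(i in pfa_accept P) final_distribution P w 0 i.

Definition S_eq (R : realType) (Sigma : finType) : set (set (seq Sigma)) :=
  [set L | exists (P : pfa R Sigma) (lambda : R),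
     0 <= lambda <= 1 /\ L = [set w | accept_prob P w = lambda]].

Definition S_neq (R : realType) (Sigma : finType) : set (set (seq Sigma)) :=
  [set L | exists (P : pfa R Sigma) (lambda : R),
     0 <= lambda <= 1 /\ L = [set w | accept_prob P w <> lambda]].

(* A language class assigns to each finite alphabet a set of languages over it. *)
Definition closed_under_difference
    (C : forall Sigma : finType, set (set (seq Sigma))) : Prop :=
  forall (Sigma : finType) (L1 L2 : set (seq Sigma)),
    C Sigma L1 -> C Sigma L2 -> C Sigma (L1 `\` L2).

(* Main.v *)
Require Import Defs.
From mathcomp Require Import all_boot all_order all_algebra.
From mathcomp Require Import boolp classical_sets reals.
From mathcomp Require Import lra.

(** Over the alphabet [bool], the language EQ of words with as many letters
    [true] as [false] is in S^=: a PFA halving one of two probabilities at each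
    letter compares 2^-|w|_true with 2^-|w|_false.  Its complement is not in
    S^=: by Cayley-Hamilton, a language of S^= recognised with k states which
    contains u x^i for all i < k contains u x^i for all i, which fails for
    u = true^k and x = false.  Since the full language is in both classes,
    closure under difference would give closure under complement, and S^<> is
    the class of complements of languages of S^=. *)

Set Implicit Arguments.
Unset Strict Implicit.
Unset Printing Implicit Defensive.

Import Order.TTheory GRing.Theory Num.Theory.
Local Open Scope ring_scope.
Local Open Scope classical_set_scope.

Lemma horner_mx_coef (F : fieldType) (n : nat) (A : 'M[F]_n.+1) (p : {poly F}) :
  horner_mx A p = \sum_(i < size p) p`_i *: A ^+ i.
Proof.
rewrite -[in LHS](coefK p) poly_def rmorph_sum /=.
by apply: eq_bigr => i _; rewrite linearZ /= rmorphXn /= horner_mx_X.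
Qed.

(** By Cayley-Hamilton, [A ^+ m] is the value at [A] of the remainder of ['X^m] modulo the
    characteristic polynomial. This polynomial has degree [n.+1], so only powers below [n.+1]
    remain, and each contributes 0. *)
Lemma mulmx_exp_eq0 (F : fieldType) (n : nat) (A : 'M[F]_n.+1)
    (v : 'rV[F]_n.+1) (c : 'cV[F]_n.+1) :
  (forall i, (i < n.+1)%N -> v *m A ^+ i *m c = 0) ->
  forall m, v *m A ^+ m *m c = 0.
Proof.
move=> vAc0 m; set p := char_poly A.
have p0 : p != 0 by rewrite monic_neq0 ?char_poly_monic.
have -> : A ^+ m = horner_mx A ('X^m %% p).
  rewrite -[in LHS](horner_mx_X A) -rmorphXn /= [in LHS](divp_eq 'X^m p).
  by rewrite rmorphD rmorphM /= Cayley_Hamilton mulr0 add0r.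
rewrite horner_mx_coef mulmx_sumr mulmx_suml big1 // => i _.
have sz : (size ('X^m %% p)%R <= n.+1)%N.
  by rewrite -ltnS -(size_char_poly A) ltn_modp.
by rewrite -scalemxAr -scalemxAl vAc0 ?scaler0 // (leq_trans (ltn_ord i)).
Qed.

Section AcceptProb.
Variables (R : realType) (Sigma : finType) (P : pfa R Sigma).

Let run (v : 'rV[R]_(pfa_dim P).+1) s := foldl (fun v s => v *m pfa_trans P s) v s.

Lemma sum_mulmx_stochastic (n : nat) (A : 'M[R]_n) (v : 'rV[R]_n) :
  stochastic A -> \sum_j (v *m A) 0 j = \sum_j v 0 j.
Proof.
move=> [_ A1]; under eq_bigr do rewrite mxE.
by rewrite exchange_big; apply: eq_bigr => i _; rewrite -mulr_sumr A1 mulr1.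
Qed.

Lemma sum_final_distribution (w : seq Sigma) :
  \sum_i final_distribution P w 0 i = 1.
Proof.
rewrite /final_distribution -/(run _ _).
have -> (s : seq (tape_symbol Sigma)) v : \sum_i run v s 0 i = \sum_i v 0 i.
  elim: s v => //= x s IHs v.
  by rewrite IHs sum_mulmx_stochastic //; apply: pfa_transP.
rewrite (bigD1 ord0) //= mxE !eqxx big1 ?addr0 // => i /negPf i0.
by rewrite mxE i0 andbF.
Qed.

(** As the final distribution has total mass 1, the constant [lambda] can be absorbed into the
    column of final weights. The affine condition of acceptance with probability [lambda] thus
    becomes the vanishing of a linear form. *)
Lemma accept_probB (lambda : R) (w : seq Sigma) :
  ((accept_prob P w - lambda)%:M : 'M_1) =
  final_distribution P w *m (\col_i ((i \in pfa_accept P)%:R - lambda)).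
Proof.
rewrite [RHS]mx11_scalar !mxE; congr (_%:M).
under eq_bigr do rewrite mxE mulrBr.
rewrite sumrB -mulr_suml sum_final_distribution mul1r; congr (_ - _).
rewrite /accept_prob big_mkcond; apply: eq_bigr => i _.
by case: ifP => _; rewrite ?mulr1 ?mulr0.
Qed.

Lemma final_distribution_cat_nseq (u : seq Sigma) (x : Sigma) (m : nat) :
  final_distribution P (u ++ nseq m x) =
  run (delta_mx 0 ord0) (LeftEnd :: map (@Letter Sigma) u)
    *m pfa_trans P (Letter x) ^+ m *m pfa_trans P RightEnd.
Proof.
have -> : final_distribution P (u ++ nseq m x) =
    run (delta_mx 0 ord0)
      ((LeftEnd :: map (@Letter Sigma) u) ++ nseq m (Letter x) ++ [:: RightEnd]).
  by rewrite /final_distribution /tape map_cat map_nseq -cats1 -catA.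
rewrite /run !foldl_cat -!/(run _ _) /=; congr (_ *m _).
elim: m (run _ [seq _ | _ <- _]) => [|m IHm] v; first by rewrite expr0 mulmx1.
by rewrite exprS mulmxA -IHm.
Qed.

End AcceptProb.

Lemma S_eq_pumping (R : realType) (Sigma : finType) (L : set (seq Sigma)) :
  S_eq R L ->
  exists k : nat, forall (u : seq Sigma) (x : Sigma),
    (forall i, (i < k)%N -> L (u ++ nseq i x)) ->
    forall m, L (u ++ nseq m x).
Proof.
move=> [P [lambda [_ ->]]]; exists (pfa_dim P).+1 => u x Lu m.
have eq_lambda w : accept_prob P w = lambda <->
    final_distribution P w *m (\col_i ((i \in pfa_accept P)%:R - lambda)) = 0.
  rewrite -accept_probB; split=> [->|]; first by rewrite subrr raddf0.
  by move/matrixP/(_ 0 0); rewrite !mxE eqxx => /eqP; rewrite subr_eq0 => /eqP.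
(* The right end-marker joins the column vector, while the left one and [u] form the row vector.
   Only the power of the matrix of [x] stays in between. *)
apply/eq_lambda; rewrite final_distribution_cat_nseq -mulmxA.
apply: mulmx_exp_eq0 => i /Lu /eq_lambda.
by rewrite final_distribution_cat_nseq -mulmxA.
Qed.

Definition balanced : set (seq bool) :=
  [set w | count_mem true w = count_mem false w].

Lemma setC_balanced_notin_S_eq (R : realType) : ~ S_eq R (~` balanced).
Proof.
move=> /S_eq_pumping[k pump].
(* Fewer than [k] letters [false] cannot balance [true^k], but exactly [k] of them do. *)
apply: (pump (nseq k true) false _ k) => [i ik|];
  rewrite /balanced /= !count_cat !count_nseq /= !mul1n !mul0n addn0 add0n //.
by move=> ki; rewrite ki ltnn in ik.
Qed.

Section BalancedPFA.
Variable R : realType.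

(* Letter [true] (resp. [false]) moves half of the mass of state 0 (resp. 1) to
   state 2, whose mass is shared evenly between 0 and 1 at the end. *)
Definition balanced_rows (s : tape_symbol bool) : seq (seq R) :=
  match s with
  | LeftEnd => nseq 3 [:: 2^-1; 2^-1; 0]
  | Letter true => [:: [:: 2^-1; 0; 2^-1]; [:: 0; 1; 0]; [:: 0; 0; 1]]
  | Letter false => [:: [:: 1; 0; 0]; [:: 0; 2^-1; 2^-1]; [:: 0; 0; 1]]
  | RightEnd => [:: [:: 1; 0; 0]; [:: 0; 1; 0]; [:: 2^-1; 2^-1; 0]]
  end.

Definition balanced_trans (s : tape_symbol bool) : 'M[R]_3 :=
  \matrix_(i, j) (nth [::] (balanced_rows s) i)`_j.

Lemma balanced_trans_stochastic s : stochastic (balanced_trans s).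
Proof.
split=> [i j|i].
  rewrite mxE; case: i j => [[|[|[|//]]] ?] [[|[|[|//]]] ?];
  by case: s => [|[]|] /=; lra.
rewrite !big_ord_recl big_ord0 !mxE.
by case: i => [[|[|[|//]]] ?]; case: s => [|[]|] /=; lra.
Qed.

Definition balanced_pfa : pfa R bool :=
  PFA balanced_trans_stochastic [set ord0].

(** No letter moves mass into state 0 or 1 from another state, so these two masses evolve
    independently, whatever the mass in state 2. *)
Lemma balanced_pfa_letters (w : seq bool) (v : 'rV[R]_3) :
  let v' := foldl (fun v s => v *m balanced_trans s) v (map (@Letter bool) w) in
  v' 0 0 = v 0 0 * 2^-1 ^+ count_mem true w /\
  v' 0 1 = v 0 1 * 2^-1 ^+ count_mem false w.
Proof.
elim: w v => [|x w IHw] v /=; first by rewrite !mulr1.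
have [-> ->] := IHw (v *m balanced_trans (Letter x)).
rewrite !mxE !big_ord_recl !big_ord0 !mxE.
have -> : lift ord0 ord0 = 1 :> 'I_3 by apply/val_inj.
by case: x => /=; rewrite ?add0n ?add1n ?exprS; split; lra.
Qed.

Lemma accept_prob_balanced (w : seq bool) :
  accept_prob balanced_pfa w =
  2^-1 + 4^-1 * (2^-1 ^+ count_mem true w - 2^-1 ^+ count_mem false w).
Proof.
(* Conservation of mass gives the content of state 2 before the right end-marker. With a and b the
   two powers of 1/2, it is 1 - a/2 - b/2, so state 0 ends with a/2 + (1 - a/2 - b/2)/2 = 1/2 + (a -
   b)/4. *)
have := sum_final_distribution balanced_pfa w.
rewrite /accept_prob big_set1 /final_distribution /= -cats1 foldl_cat.
set v0 := delta_mx _ _ *m _.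
have [] := balanced_pfa_letters w v0.
set v := foldl _ _ _ => /=; rewrite sum_mulmx_stochastic; last first.
  exact: balanced_trans_stochastic.
have v00 : v0 0 0 = 2^-1.
  by rewrite !mxE !big_ord_recl big_ord0 !mxE /=; lra.
have v01 : v0 0 1 = 2^-1.
  by rewrite !mxE !big_ord_recl big_ord0 !mxE /=; lra.
rewrite v00 v01 mxE !big_ord_recl !big_ord0 !mxE /=.
have -> : lift ord0 ord0 = 1 :> 'I_3 by apply/val_inj.
have -> : ord0 = 0 :> 'I_3 by [].
by move=> -> ->; lra.
Qed.

Lemma balanced_in_S_eq : S_eq R balanced.
Proof.
exists balanced_pfa, 2^-1; split; first by apply/andP; split; lra.
apply/seteqP; split=> w /=; rewrite accept_prob_balanced /balanced /=.
  by move=> ->; rewrite subrr mulr0 addr0.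
move=> eq_half; have half0 : 0 < (2^-1 : R) by lra.
have half1 : (2^-1 : R) < 1 by lra.
apply: (ieexprIn half0 (negbT (lt_eqF half1))); lra.
Qed.

End BalancedPFA.

Section FullLanguage.
Variables (R : realType) (Sigma : finType).

Lemma stochastic1 (n : nat) : stochastic (1%:M : 'M[R]_n).
Proof.
split=> [i j|i]; first by rewrite mxE ler0n.
rewrite (bigD1 i) //= mxE eqxx big1 ?addr0 // => j /negPf ji.
by rewrite mxE eq_sym ji.
Qed.

(** One automaton serves both classes: the full language arises from cut point 0 for [S_eq] and from
    cut point 1 for [S_neq]. *)
Definition null_pfa : pfa R Sigma :=
  @PFA R Sigma 0 (fun=> 1%:M) (fun=> stochastic1 1) finset.set0.

Lemma accept_prob_null (w : seq Sigma) : accept_prob null_pfa w = 0.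
Proof. by rewrite /accept_prob big_set0. Qed.

Lemma setT_in_S_eq : S_eq R (setT : set (seq Sigma)).
Proof.
exists null_pfa, 0; rewrite lexx ler01; split=> //.
by apply/seteqP; split=> w //= _; rewrite accept_prob_null.
Qed.

Lemma setT_in_S_neq : S_neq R (setT : set (seq Sigma)).
Proof.
exists null_pfa, 1; rewrite lexx ler01; split=> //.
apply/seteqP; split=> w //= _; rewrite accept_prob_null.
by move/eqP; rewrite eq_sym oner_eq0.
Qed.

Lemma S_neq_setC (L : set (seq Sigma)) : S_neq R L <-> S_eq R (~` L).
Proof.
split=> -[P [lambda [lambda01 LE]]]; exists P, lambda; split=> //.
  by rewrite LE; apply/seteqP; split=> w /= => [/contrapT|->].
by rewrite -[L]setCK LE.
Qed.

End FullLanguage.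

Theorem theorem5p10 (R : realType) :
  ~ closed_under_difference (S_neq R) /\ ~ closed_under_difference (S_eq R).
Proof.
have eqS := balanced_in_S_eq R; have neqNS := @setC_balanced_notin_S_eq R.
split=> closed.
(* Here the language subtracted from [setT] is the complement of [balanced], which is in [S_neq].
   The difference [balanced] would then be in [S_neq] too, putting its complement in [S_eq]. *)
- apply: neqNS; apply/S_neq_setC; rewrite -[balanced]setCK -setTD.
  by apply: closed; [exact: setT_in_S_neq | apply/S_neq_setC; rewrite setCK].
- by apply: neqNS; rewrite -setTD; apply: closed; [exact: setT_in_S_eq|].
Qed.
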